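(* Let $K\in\{1,2,3\}$, $\Delta y=\Delta x$, and let $\mathcal E$ be the evolution matrix of the Discontinuous Galerkin method of degree $K$ for two-dimensional linear acoustics with the ''Low Mach'' flux, i.e. with $$D_x=\begin{pmatrix}0&0&1\\0&0&0\\-1&0&2\end{pmatrix},\qquad D_y=\begin{pmatrix}0&0&0\\0&0&1\\0&-1&2\end{pmatrix}.$$ Let $\mathbf k=(k_x,k_y)\in\mathbb R^2$ be fixed with $k_xk_y\ne0$, and let $\hat Q=(-k_y,k_x,0)^{\mathrm T}$. Then there exists a selectively optimal projector $\pi_{\mathbf k}$ onto $\ker\mathcal E$ that leads to the optimal order of accuracy, i.e. $$\widehat{\mathrm{DOF}}(\hat Q)-\pi_{\mathbf k}\widehat{\mathrm{DOF}}(\hat Q)\in\mathcal O(\Delta x^{K+1})\qquad(\Delta x\to0).$$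
   Context: Linear acoustics in 2D with variables $q=(u,v,p)$: $\partial_t q+J_x\partial_x q+J_y\partial_y q=0$ with $$J_x=\begin{pmatrix}0&0&1\\0&0&0\\1&0&0\end{pmatrix},\qquad J_y=\begin{pmatrix}0&0&0\\0&0&1\\0&1&0\end{pmatrix}.$$ Note $\hat Q=(-k_y,k_x,0)^{\mathrm T}$ spans $\ker(J_xk_x+J_yk_y)$ for $\mathbf k\neq0$. Basis: $b_0,\dots,b_K$ is the $L^2(-\frac12,\frac12)$-orthonormal polynomial basis with $\deg b_k=k$ ($b_0=1$, $b_1=2\sqrt3x$, $b_2=\frac{\sqrt5}{2}(12x^2-1)$, $b_3=\sqrt7x(20x^2-3)$), so the mass matrix is $M^k_\alpha=\delta_{k\alpha}$. Put $G^k_\alpha=\int_{-1/2}^{1/2}b_k'(\xi)b_\alpha(\xi)\,d\xi$. Numerical fluxes: $\hat f^x(q_L,q_R)=J_x\frac{q_L+q_R}{2}-D_x\frac{q_R-q_L}{2}$, and analogously $\hat f^y$ with $J_y,D_y$. Evolution matrix: let $t_x=e^{\mathrm ik_x\Delta x}$, $t_y=e^{\mathrm ik_y\Delta y}$. Inserting $q_{ij}^{(\alpha\beta)}(t)=\hat q^{(\alpha\beta)}(t)t_x^it_y^j$ (with $\hat q^{(\alpha\beta)}\in\mathbb C^3$) in the semi-discrete DG method of tensor-product degree $K$ yields $\frac{d}{dt}\hat q^{(k\ell)}+\sum_{\alpha,\beta=0}^K\mathcal E^{k\ell}_{\alpha\beta}\hat q^{(\alpha\beta)}=0$, where the $3\times3$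 blocks of $\mathcal E\in\mathbb C^{3(K+1)^2\times3(K+1)^2}$ are $$\begin{aligned}\mathcal E^{k\ell}_{\alpha\beta}=&-\tfrac1{\Delta x}J_xM^\ell_\beta G^k_\alpha-\tfrac1{\Delta y}J_yM^k_\alpha G^\ell_\beta\\&+\frac{b_k(\frac12)t_x-b_k(-\frac12)}{t_x\Delta x}\left(J_x\frac{b_\alpha(\frac12)+t_xb_\alpha(-\frac12)}2-D_x\frac{t_xb_\alpha(-\frac12)-b_\alpha(\frac12)}2\right)M^\ell_\beta\\&+\frac{b_\ell(\frac12)t_y-b_\ell(-\frac12)}{t_y\Delta y}\left(J_y\frac{b_\beta(\frac12)+t_yb_\beta(-\frac12)}2-D_y\frac{t_yb_\beta(-\frac12)-b_\beta(\frac12)}2\right)M^k_\alpha .\end{aligned}$$ Degrees of freedom of the Fourier mode $\hat Q e^{\mathrm i\mathbf k\cdot\mathbf x}$: for $0\le k,\ell\le K$, $$\widehat{\mathrm{DOF}}(\hat Q)_{k\ell}=\hat Q\,\frac1{\Delta x\Delta y}\int_{-\Delta x/2}^{\Delta x/2}\int_{-\Delta y/2}^{\Delta y/2}b_k\!\left(\tfrac x{\Delta x}\right)b_\ell\!\left(\tfrac y{\Delta y}\right)e^{\mathrm ik_xx}e^{\mathrm ik_yy}\,dy\,dx\in\mathbb C^3 .$$ Selectively optimal projector: a map (more precisely, a family of maps depending on $\Delta x$) $\pi_{\mathbf k}:\mathbb C^{3(K+1)^2}\to\ker\mathcal E$, not required to be linear or idempotent (it may be affine), for which there is an index set $I\subset\{1,\dots,3(K+1)^2\}$,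 independent of $\Delta x$, with $\#I=\dim\ker\mathcal E$ for all small $\Delta x$ and $(\pi_{\mathbf k}\hat q)_i=\hat q_i+\mathcal O(\Delta x^{K+1})$ as $\Delta x\to0$ for all $i\in I$ and all $\hat q\in\mathbb C^{3(K+1)^2}$. *)

(* Defs.v *)
From HB Require Import structures.
From mathcomp Require Import all_boot all_order all_algebra.
From mathcomp Require Import complex.
From mathcomp Require Import all_classical all_reals all_analysis.
Set Implicit Arguments.
Unset Strict Implicit.
Unset Printing Implicit Defensive.
Import Order.TTheory GRing.Theory Num.Theory.
Import numFieldNormedType.Exports.
Local Open Scope classical_set_scope.
Local Open Scope ring_scope.
Local Open Scope complex_scope.

Definition cis (R : realType) (t : R) : R[i] := cos t +i* sin t.

Definition Cintegral (R : realType) (a b : R) (f : R -> R[i]) : R[i] :=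
  (\int[@lebesgue_measure R]_(x in `[a, b]) complex.Re (f x))
  +i* (\int[@lebesgue_measure R]_(x in `[a, b]) complex.Im (f x)).

(* f(h) = O(h ^ m) as h -> 0 with h > 0; R[i] carries no R-normed structure,
   hence the detour through the real-valued modulus. *)
Definition bigO_pow (R : realType) (m : nat) (f : R -> R[i]) : Prop :=
  (fun h => Normc.normc (f h) : R^o) =O_ (0^'+) (fun h => h ^+ m : R^o).

Definition mx3 (A : pzRingType) (rows : seq (seq A)) : 'M[A]_3 :=
  \matrix_(i, j) nth 0 (nth [::] rows i) j.

Definition J_x (R : realType) : 'M[R[i]]_3 :=
  mx3 [:: [:: 0; 0; 1]; [:: 0; 0; 0]; [:: 1; 0; 0]].
Definition J_y (R : realType) : 'M[R[i]]_3 :=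
  mx3 [:: [:: 0; 0; 0]; [:: 0; 0; 1]; [:: 0; 1; 0]].

Definition low_mach_D_x (R : realType) : 'M[R[i]]_3 :=
  mx3 [:: [:: 0; 0; 1]; [:: 0; 0; 0]; [:: -1; 0; 2]].
Definition low_mach_D_y (R : realType) : 'M[R[i]]_3 :=
  mx3 [:: [:: 0; 0; 0]; [:: 0; 0; 1]; [:: 0; -1; 2]].

(* The L^2(-1/2, 1/2)-orthonormal polynomials of degree 0, 1, 2, 3; the value
   for k > 3 is a dummy, only degrees K <= 3 being considered. *)
Definition dg_basis (R : realType) (k : nat) : {poly R} :=
  match k with
  | 0 => 1
  | 1 => (2 * Num.sqrt 3) *: 'X
  | 2 => (Num.sqrt 5 / 2) *: (12 *: 'X^2 - 1)
  | 3 => Num.sqrt 7 *: ('X * (20 *: 'X^2 - 3%:P))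
  | _ => 0
  end.

Definition mass (R : realType) (k a : nat) : R :=
  \int[@lebesgue_measure R]_(x in `[- 2^-1, 2^-1])
    ((dg_basis R k).[x] * (dg_basis R a).[x]).

Definition stiff (R : realType) (k a : nat) : R :=
  \int[@lebesgue_measure R]_(x in `[- 2^-1, 2^-1])
    ((dg_basis R k)^`().[x] * (dg_basis R a).[x]).

(* b_k(1/2) and b_k(-1/2) *)
Definition trace_r (R : realType) (k : nat) : R[i] := (dg_basis R k).[2^-1]%:C.
Definition trace_l (R : realType) (k : nat) : R[i] :=
  (dg_basis R k).[- 2^-1]%:C.

(* The numerical flux q_L, q_R |-> J (q_L + q_R) / 2 - D (q_R - q_L) / 2 as a
   matrix acting on q, for q_L = a q and q_R = b q. *)
Definition num_flux (R : realType) (J D : 'M[R[i]]_3) (a b : R[i]) :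
    'M[R[i]]_3 :=
  ((a + b) / 2) *: J - ((b - a) / 2) *: D.

Definition evolution_block (R : realType) (D_x D_y : 'M[R[i]]_3)
    (kx ky dx dy : R) (k l a b : nat) : 'M[R[i]]_3 :=
  let tx := cis (kx * dx) in
  let ty := cis (ky * dy) in
  - (dx^-1 * mass R l b * stiff R k a)%:C *: J_x R
  - (dy^-1 * mass R k a * stiff R l b)%:C *: J_y R
  + ((trace_r R k * tx - trace_l R k) / (tx * dx%:C) * (mass R l b)%:C) *:
      num_flux (J_x R) D_x (trace_r R a) (tx * trace_l R a)
  + ((trace_r R l * ty - trace_l R l) / (ty * dy%:C) * (mass R k a)%:C) *:
      num_flux (J_y R) D_y (trace_r R b) (ty * trace_l R b).

(* A degree of freedom is ((k, l), c): basis function b_k(x) b_l(y), component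
   c of (u, v, p).  Vectors of C^(3(K+1)^2) are indexed through the enumeration
   of these triples. *)
Definition dof_index (K : nat) : finType := ('I_K.+1 * 'I_K.+1 * 'I_3)%type.
Definition ndof (K : nat) : nat := #|dof_index K|.

Lemma ndofE (K : nat) : ndof K = (3 * K.+1 ^ 2)%N.
Proof. by rewrite /ndof !card_prod !card_ord mulnC expnS expn1. Qed.

Definition evolution (R : realType) (K : nat) (D_x D_y : 'M[R[i]]_3)
    (kx ky dx dy : R) : 'M[R[i]]_(ndof K) :=
  \matrix_(i, j)
    let: (k, l, c) := enum_val i : dof_index K in
    let: (a, b, c') := enum_val j : dof_index K in
    evolution_block D_x D_y kx ky dx dy k l a b c c'.

Definition Qhat (R : realType) (kx ky : R) : 'cV[R[i]]_3 :=
  \col_c [:: (- ky)%:C; kx%:C; 0]`_c.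

Definition DOFhat (R : realType) (K : nat) (kx ky dx dy : R) :
    'cV[R[i]]_(ndof K) :=
  \col_i
    let: (k, l, c) := enum_val i : dof_index K in
    Qhat kx ky c 0 * ((dx * dy)^-1)%:C *
    Cintegral (- (dx / 2)) (dx / 2) (fun x =>
      Cintegral (- (dy / 2)) (dy / 2) (fun y =>
        (dg_basis R k).[x / dx]%:C * (dg_basis R l).[y / dy]%:C
        * cis (kx * x) * cis (ky * y))).

(* E and proj are families indexed by the mesh width.  ker E is the space of
   column vectors q with E q = 0; it is spanned by the columns of cokermx E,
   whose rank is therefore dim ker E.  The vector q is fixed as the mesh width
   tends to 0, and the constant in the O may depend on q. *)
Definition selectively_optimal_projector (R : realType) (K : nat)
    (E : R -> 'M[R[i]]_(ndof K))
    (proj : R -> 'cV[R[i]]_(ndof K) -> 'cV[R[i]]_(ndof K)) : Prop :=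
  (forall dx : R, 0 < dx -> forall q, E dx *m proj dx q = 0) /\
  exists I : {set 'I_(ndof K)},
    (\forall dx \near 0^'+, #|I| = \rank (cokermx (E dx))) /\
    (forall i, i \in I -> forall q,
       bigO_pow K.+1 (fun dx => proj dx q i 0 - q i 0)).

(* Main.v *)
Require Import Defs.
From mathcomp Require Import all_boot all_order all_algebra.
From mathcomp Require Import complex ring lra zify.
From mathcomp Require Import all_classical all_reals all_analysis.
From mathcomp Require polyorder.
Import Order.TTheory GRing.Theory Num.Theory.
Import numFieldNormedType.Exports.
Local Open Scope ring_scope.
Local Open Scope complex_scope.

(** At wave number [k] with [e^(i k_x h)], [e^(i k_y h)] different from 1, the
    Low Mach flux decouples the kernel of the evolution matrix: the velocity
    equations are invertible upwind DG derivatives of [p], so [p = 0], and what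
    is left is [A_x u + A_y v = 0] with invertible downwind DG derivatives [A_x],
    [A_y]. Hence [u] is free and determines [v], which gives [I] = the [u]-degrees
    of freedom and a linear section [S] with [(S q)_i = q_i] on [I].

    Let [c] be the [L^2]-projection of [e^(i t x)] on the cell and [r] its
    Gauss-Radau projection (same moments below degree [K], exact left trace).
    Then [A r = i t c] exactly, while [r - c = O(t^(K+1))]. Therefore
    [w = (- k_y r(k_x h) * c(k_y h), k_x c(k_x h) * r(k_y h), 0)] (tensor products)
    is in the kernel and is [O(h^(K+1))]-close to [DOF], whose components are
    [- k_y c * c] and [k_x c * c]. The projector is the affine map
    [q |-> w + S (q - DOF)]. *)

(** * Integrals of continuous functions over segments *)
Section IntegralSegment.
Context {R : realType}.
Implicit Types (f g : R -> R) (a b h : R).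

Lemma integrable_continuous a b f : continuous f ->
  (@lebesgue_measure R).-integrable `[a, b]%classic (EFin \o f).
Proof.
move=> cf; apply: continuous_compact_integrable; first exact: segment_compact.
exact: continuous_subspaceT.
Qed.

Lemma Rintegral_continuousD a b f g : continuous f -> continuous g ->
  \int[@lebesgue_measure R]_(x in `[a, b]) (f x + g x) =
  \int[@lebesgue_measure R]_(x in `[a, b]) f x +
  \int[@lebesgue_measure R]_(x in `[a, b]) g x.
Proof. by move=> cf cg; rewrite RintegralD//; exact: integrable_continuous. Qed.

Lemma Rintegral_continuousB a b f g : continuous f -> continuous g ->
  \int[@lebesgue_measure R]_(x in `[a, b]) (f x - g x) =
  \int[@lebesgue_measure R]_(x in `[a, b]) f x -
  \int[@lebesgue_measure R]_(x in `[a, b]) g x.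
Proof. by move=> cf cg; rewrite RintegralB//; exact: integrable_continuous. Qed.

Lemma Rintegral_continuousZ a b c f : continuous f ->
  \int[@lebesgue_measure R]_(x in `[a, b]) (c * f x) =
  c * \int[@lebesgue_measure R]_(x in `[a, b]) f x.
Proof. by move=> cf; rewrite RintegralZl//; exact: integrable_continuous. Qed.

Lemma Rintegral_norm_le a b f c : a <= b -> continuous f ->
  (forall x, a <= x <= b -> `|f x| <= c) ->
  `|\int[@lebesgue_measure R]_(x in `[a, b]) f x| <= c * (b - a).
Proof.
move=> ab cf fc; apply: (le_trans (le_normr_Rintegral _ _)) => //.
  exact: integrable_continuous.
have -> : c * (b - a) = \int[@lebesgue_measure R]_(_ in `[a, b]) c.
  rewrite Rintegral_cst//= lebesgue_measure_itv/= lte_fin.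
  by case: ltP => //= ba; rewrite (le_anti _ : a = b) ?subrr ?mulr0// ab ba.
apply: le_Rintegral => //.
- apply: integrable_continuous => x.
  by apply: continuous_comp; [exact: cf | exact: norm_continuous].
- by apply: integrable_continuous => x; exact: cst_continuous.
Qed.

(** A derivative on the whole line gives the boundary regularity in the form required by the
    integration theorems used below. *)
Lemma derivable_LRcontinuous a b F f : (forall x : R, is_derive x 1 F (f x)) ->
  derivable_oo_LRcontinuous F a b.
Proof.
move=> dF; have cF x : {for x, continuous F}.
  by apply: differentiable_continuous; apply/derivable1_diffP.
split; first by move=> x _; exact: (@ex_derive _ _ _ _ _ _ _ (dF x)).
- by apply: cvg_at_right_filter; exact: cF.
- by apply: cvg_at_left_filter; exact: cF.
Qed.

Lemma Rintegral_by_parts a b F G f g : a < b ->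
  continuous f -> (forall x : R, is_derive x 1 F (f x)) ->
  continuous g -> (forall x : R, is_derive x 1 G (g x)) ->
  \int[@lebesgue_measure R]_(x in `[a, b]) (F x * g x) =
  F b * G b - F a * G a - \int[@lebesgue_measure R]_(x in `[a, b]) (f x * G x).
Proof.
move=> ab cf dF cg dG; apply: Rintegration_by_parts => //.
- exact: continuous_subspaceT.
- exact: derivable_LRcontinuous dF.
- by move=> x _; rewrite derive1E derive_val.
- exact: continuous_subspaceT.
- exact: derivable_LRcontinuous dG.
- by move=> x _; rewrite derive1E derive_val.
Qed.

Lemma Rintegral_FTC a b F f : a < b -> continuous f ->
  (forall x : R, is_derive x 1 F (f x)) ->
  \int[@lebesgue_measure R]_(x in `[a, b]) f x = F b - F a.
Proof.
move=> ab cf dF; rewrite /Rintegral (@continuous_FTC2 R f F)//.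
- exact: continuous_subspaceT.
- exact: derivable_LRcontinuous dF.
- by move=> x _; rewrite derive1E derive_val.
Qed.

(** Substitution [x = h * y], which carries a mesh cell to the reference cell. *)
Lemma Rintegral_scale a b h f : 0 < h -> a < b -> continuous f ->
  \int[@lebesgue_measure R]_(x in `[h * a, h * b]) f (x / h) =
  h * \int[@lebesgue_measure R]_(x in `[a, b]) f x.
Proof.
move=> h0 ab cf; rewrite -Rintegral_continuousZ//.
have dF (x : R) : is_derive x 1 ( *%R h) h.
  have -> : *%R h = h \*: id :> (R -> R) by apply/funext.
  by apply: is_derive_eq; rewrite /GRing.scale/= mulr1.
have F' : (( *%R h)^`())%classic = cst h.
  by apply/funext => x; rewrite derive1E derive_val.
rewrite {1}/Rintegral.
rewrite (@integration_by_substitution_increasing R ( *%R h)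
  (fun x => f (x / h)) a b) ?(ltW ab)//.
- rewrite F'/Rintegral/=; congr fine; apply: eq_integral => x _.
  by congr EFin; change (f (h * x / h) * h = h * f x);
    rewrite [h * x]mulrC mulfK ?gt_eqF// mulrC.
- by move=> x y _ _ xy; rewrite ltr_pM2l.
- by rewrite F' => x _; exact: cst_continuous.
- by rewrite F'; apply: is_cvg_cst.
- by rewrite F'; apply: is_cvg_cst.
- exact: derivable_LRcontinuous dF.
- apply: continuous_subspaceT => x.
  apply: (@continuous_comp R R R (fun y => y / h) f); last exact: cf.
  by apply: cvgMl; exact: cvg_id.
Qed.

End IntegralSegment.

(** * Taylor polynomials of cosine and sine *)
Section TaylorTrigo.
Context {R : realType}.

Lemma is_derive_horner (p : {poly R}) (x : R) :
  is_derive x 1 (horner p) p^`().[x].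
Proof.
apply: DeriveDef; first exact: derivable_horner.
by rewrite derivE derive1E.
Qed.

Lemma poly_primitive (p : {poly R}) :
  exists q : {poly R}, [/\ q^`()%R = p, q.[0] = 0 & (size q <= (size p).+1)%N].
Proof.
exists (\poly_(i < (size p).+1) (if i is j.+1 then p`_j / j.+1%:R else 0)); split.
- apply/polyP => i; rewrite coef_deriv coef_poly ltnS.
  case: ltnP => hi; last by rewrite mul0rn nth_default.
  by rewrite /= -[LHS]mulr_natr divfK// pnatr_eq0.
- by rewrite horner_coef0 coef_poly.
- exact: size_poly.
Qed.

(** Mean value theorem: [|f x| = |df c| * |x|] with [|c| <= |x|]. No factorial is tracked, since the
    constant 1 is enough for an order estimate. *)
Lemma norm_le_exp_of_derive (f df : R -> R) n :
  f 0 = 0 -> (forall x : R, is_derive x 1 f (df x)) ->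
  (forall x, `|df x| <= `|x| ^+ n) -> forall x, `|f x| <= `|x| ^+ n.+1.
Proof.
move=> f0 dF le_df x.
have cf : continuous f.
  by move=> y; apply: differentiable_continuous; apply/derivable1_diffP.
have [x0|x0] := leP 0 x.
- have [|c cx] := @MVT_segment R f df 0 x x0 (fun y _ => dF y).
    exact: continuous_subspaceT.
  rewrite f0 !subr0 => ->; rewrite normrM exprSr ler_wpM2r//.
  apply: (le_trans (le_df c)); rewrite lerXn2r ?nnegrE//.
  by move: cx; rewrite in_itv/= => /andP[c0 cx]; rewrite !ger0_norm.
- have [|c cx] := @MVT_segment R f df x 0 (ltW x0) (fun y _ => dF y).
    exact: continuous_subspaceT.
  rewrite f0 !sub0r => /eqP; rewrite mulrN eqr_opp => /eqP ->.
  rewrite normrM exprSr ler_wpM2r//.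
  apply: (le_trans (le_df c)); rewrite lerXn2r ?nnegrE//.
  move: cx; rewrite in_itv/= => /andP[cx c0].
  by rewrite !ler0_norm ?(ltW x0)// lerN2.
Qed.

(** Integrating both approximations from 0 raises the order by one: a primitive of [p] serves for
    sine, and 1 minus a primitive of [q] for cosine. *)
Lemma cos_sin_taylor n : exists p q : {poly R},
  [/\ (size p <= n)%N, (size q <= n)%N,
      forall x, `|cos x - p.[x]| <= `|x| ^+ n &
      forall x, `|sin x - q.[x]| <= `|x| ^+ n].
Proof.
elim: n => [|n [p [q [sp sq cp sqx]]]].
  exists 0, 0; split; rewrite ?size_poly0// => x; rewrite horner0 subr0 expr0.
    by rewrite ler_norml cos_geN1 cos_le1.
  by rewrite ler_norml sin_geN1 sin_le1.
have [P [dP P0 sP]] := poly_primitive p.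
have [Q [dQ Q0 sQ]] := poly_primitive q.
exists (1 - Q), P; split.
- rewrite (leq_trans (size_polyD _ _))// geq_max size_polyN size_poly1 /=.
  exact: leq_trans sQ _.
- exact: leq_trans sP _.
- apply: (@norm_le_exp_of_derive _ (fun x => - (sin x - q.[x]))).
  + by rewrite cos0 !hornerE Q0 subr0 subrr.
  + move=> x; have := is_derive_horner (1 - Q) x.
    rewrite derivB derivC dQ sub0r hornerN => ?.
    by apply: is_derive_eq; rewrite opprK opprB addrC.
  + by move=> x; rewrite normrN.
- apply: (@norm_le_exp_of_derive _ (fun x => cos x - p.[x])) => //.
  + by rewrite sin0 P0 subr0.
  + by move=> x; have := is_derive_horner P x; rewrite dP => ?; apply: is_derive_eq.
Qed.

End TaylorTrigo.

(** * The orthonormal basis *)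
Section Basis.
Context {R : realType}.
Implicit Types (p q : {poly R}).
Local Notation b := (dg_basis R).

Definition polyip p q : R :=
  \int[@lebesgue_measure R]_(x in `[- 2^-1, 2^-1]) (p.[x] * q.[x]).

Lemma continuousM_horner p (f : R -> R) : continuous f ->
  continuous (fun x => p.[x] * f x).
Proof. by move=> cf x; apply: cvgM; [exact: continuous_horner | exact: cf]. Qed.

Lemma polyipC p q : polyip p q = polyip q p.
Proof. by rewrite /polyip; under eq_Rintegral do rewrite mulrC. Qed.

Lemma polyipDl p1 p2 q : polyip (p1 + p2) q = polyip p1 q + polyip p2 q.
Proof.
rewrite /polyip -Rintegral_continuousD.
- by apply: eq_Rintegral => x _; rewrite hornerD mulrDl.
- by apply: continuousM_horner; exact: continuous_horner.
- by apply: continuousM_horner; exact: continuous_horner.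
Qed.

Lemma polyipZl c p q : polyip (c *: p) q = c * polyip p q.
Proof.
rewrite /polyip -Rintegral_continuousZ.
- by apply: eq_Rintegral => x _; rewrite hornerZ mulrA.
- by apply: continuousM_horner; exact: continuous_horner.
Qed.

Lemma polyip0l q : polyip 0 q = 0.
Proof. by rewrite -(scale0r 0) polyipZl mul0r. Qed.

Lemma polyip_suml n (F : 'I_n -> {poly R}) q :
  polyip (\sum_i F i) q = \sum_i polyip (F i) q.
Proof. by elim/big_rec2: _ => [|i x y _ <-]; rewrite ?polyip0l ?polyipDl. Qed.

Lemma polyipM p q r : p * q = r -> polyip p q = polyip r 1.
Proof.
by move=> <-; apply: eq_Rintegral => x _; rewrite hornerM hornerC mulr1.
Qed.

(** Odd monomials integrate to 0 over the symmetric cell. Degree 6 covers every product of two basis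
    polynomials. *)
Lemma polyip_deg6 (c : nat -> R) :
  polyip (\poly_(i < 7) c i) 1 = c 0 + c 2 / 12 + c 4 / 80 + c 6 / 448.
Proof.
rewrite polyipC /polyip; under eq_Rintegral do rewrite hornerC mul1r.
have [P [dP P0 _]] := poly_primitive (\poly_(i < 7) c i).
have PE : P = \poly_(i < 8) (if i is j.+1 then c j / j.+1%:R else 0).
  apply/polyP => i; rewrite coef_poly; case: i => [|i] /=.
    by rewrite -horner_coef0.
  have := congr1 (fun p : {poly R} => p`_i) dP.
  rewrite coef_deriv coef_poly ltnS -[LHS]mulr_natr => H.
  have i0 : i.+1%:R != 0 :> R by rewrite gt_eqF.
  apply: (mulIf i0).
  by rewrite H !ltnS; case: (i <= 6)%N; rewrite ?mul0r// divfK.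
have hlt : - 2^-1 < 2^-1 :> R by lra.
have dF (x : R) : is_derive x 1 (horner P) (\poly_(i < 7) c i).[x].
  by have := is_derive_horner P x; rewrite dP.
rewrite (@Rintegral_FTC R _ _ (horner P) _ hlt (@continuous_horner R _) dF).
rewrite PE !horner_poly !big_ord_recl !big_ord0/= /bump/=; by field.
Qed.

Lemma sqr_sqrtn (n : nat) : Num.sqrt (n%:R : R) ^+ 2 = n%:R.
Proof. by rewrite sqr_sqrtr. Qed.

(** Coefficients of the Legendre polynomial [P_k(2x)]. Splitting off the norm [sqrt (2k+1)] leaves
    rational entries, which [field] can handle. *)
Definition dg_seq (k : nat) : seq R :=
  nth [::] [:: [:: 1]; [:: 0; 2]; [:: - 2^-1; 0; 6]; [:: 0; -3; 0; 20]] k.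

Definition dg_scale (k : nat) : R := Num.sqrt (k.*2.+1)%:R.

Lemma dg_basisE k : (k < 4)%N ->
  b k = dg_scale k *: Poly (dg_seq k).
Proof.
rewrite /dg_scale => hk; apply/polyP => i; rewrite coefZ coef_Poly.
case: k hk => [|[|[|[|//]]]] _ /=; rewrite /dg_seq /=.
- rewrite sqrtr1 mul1r coef1.
  by case: i => [|[|[|[|i]]]].
- rewrite coefZ coefX.
  by case: i => [|[|[|[|i]]]] //=; rewrite ?mulr0// mulr1 mulrC.
- rewrite coefZ coefB coefZ coefXn coef1.
  case: i => [|[|[|[|i]]]] //=; by field.
- rewrite coefZ coefXM coefB coefZ coefXn coefC.
  case: i => [|[|[|[|i]]]] //=; try (by field).
  case: i => [|[|[|[|i]]]] //=; by field.
Qed.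

Lemma mass_delta k a : (k < 4)%N -> (a < 4)%N -> mass R k a = (k == a)%:R.
Proof.
move=> hk ha; change (polyip (b k) (b a) = (k == a)%:R).
rewrite !dg_basisE// polyipZl polyipC polyipZl mulrA.
(* The product of the two coefficient lists, as a Cauchy product. What remains is a finite check
   over the 16 pairs [(k, a)]. *)
pose c i := \sum_(j < i.+1) (dg_seq a)`_j * (dg_seq k)`_(i - j).
rewrite (@polyipM _ _ (\poly_(i < 7) c i)); last first.
  apply/polyP => i; rewrite coef_poly; case: ltnP => hi.
    by rewrite coefM; under eq_bigr do rewrite !coef_Poly.
  apply: nth_default; apply: leq_trans hi.
  apply: leq_trans (size_polyMleq _ _) _.
  have sP j : (j < 4)%N -> (size (Poly (dg_seq j)) <= 4)%N.
    by move=> hj; apply: leq_trans (size_Poly _) _; case: j hj => [|[|[|[|//]]]].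
  by have := sP _ hk; have := sP _ ha; lia.
rewrite polyip_deg6 /c !big_ord_recl !big_ord0 /=.
rewrite /bump /= /dg_scale.
have h1 := sqr_sqrtn 3; have h2 := sqr_sqrtn 5; have h3 := sqr_sqrtn 7.
rewrite !expr2 in h1 h2 h3.
clear c.
case: k hk => [|[|[|[|//]]]] _; case: a ha => [|[|[|[|//]]]] _;
  rewrite /dg_seq /= ?sqrtr1 ?h1 ?h2 ?h3; try (by field).
Qed.


Lemma dg_scale_neq0 k : dg_scale k != 0 :> R.
Proof. by rewrite /dg_scale gt_eqF// sqrtr_gt0. Qed.

Lemma size_dg_basis k : (k < 4)%N -> size (b k) = k.+1.
Proof.
move=> hk; rewrite dg_basisE// size_scale ?dg_scale_neq0//.
case: k hk => [|[|[|[|//]]]] _; rewrite (@PolyK _ 0) ?oner_neq0//= ?pnatr_eq0//.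
Qed.

(** Induction on the degree: subtracting the right multiple of [b n] removes the leading
    coefficient. *)
Lemma dg_basis_span n p : (n <= 4)%N -> (size p <= n)%N ->
  exists c : 'I_n -> R, p = \sum_k c k *: b k.
Proof.
elim: n p => [|n IHn] p hn sp.
  exists (fun _ => 0); rewrite big_ord0; apply/eqP; rewrite -size_poly_eq0; lia.
pose d := p`_n / lead_coef (b n).
have sb := @size_dg_basis n hn.
have lb : lead_coef (b n) != 0 by rewrite lead_coef_eq0 -size_poly_eq0 sb.
have [||c pE] := IHn (p - d *: b n); first lia.
  apply/leq_sizeP => j; rewrite leq_eqVlt => /predU1P[<-|nj].
    rewrite coefB coefZ /d [lead_coef _]lead_coefE sb/= divfK ?subrr//.
    by rewrite lead_coefE sb/= in lb.
  rewrite coefB coefZ !nth_default ?sb ?mulr0 ?subr0//.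
  exact: leq_trans sp nj.
(* Coefficient [d] at the top index, and those of the induction hypothesis below it. *)
exists (fun k => oapp c d (unlift ord_max k)).
rewrite big_ord_recr/= unlift_none/= -[LHS](subrK (d *: b n)) pE; congr (_ + _).
apply: eq_bigr => i _.
have -> : widen_ord (leqnSn n) i = lift ord_max i.
  by apply: val_inj; rewrite /= /bump leqNgt ltn_ord.
by rewrite liftK.
Qed.

Lemma dg_basis_expansion n p : (n <= 4)%N -> (size p <= n)%N ->
  p = \sum_(k < n) polyip p (b k) *: b k.
Proof.
move=> hn sp; have [c pE] := dg_basis_span n p hn sp.
rewrite [LHS]pE; apply: eq_bigr => k _; congr (_ *: _).
rewrite pE polyip_suml (bigD1 k)//= polyipZl -[polyip _ _]/(mass R k k).
have hk (i : 'I_n) : (i < 4)%N by apply: leq_trans hn.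
rewrite mass_delta// eqxx mulr1 big1 ?addr0// => i ik.
rewrite polyipZl -[polyip _ _]/(mass R i k) mass_delta//.
by rewrite (negbTE (ik : (i != k :> nat))) mulr0.
Qed.

Lemma dg_basis_orthogonal a p : (a < 4)%N -> (size p <= a)%N ->
  polyip p (b a) = 0.
Proof.
move=> ha sp; rewrite (dg_basis_expansion a p (ltnW ha) sp) polyip_suml big1// => k _.
rewrite polyipZl -[polyip (b k) _]/(mass R k a).
by rewrite mass_delta ?(ltn_trans (ltn_ord k) ha)// ltn_eqF// mulr0.
Qed.

Lemma size_deriv_dg_basis k : (k < 4)%N -> (size (b k)^`()%R <= k)%N.
Proof.
move=> hk; have := lt_size_deriv (p := b k).
by rewrite -size_poly_eq0 size_dg_basis//; apply.
Qed.

(** The derivative of [b k] has degree below [k <= a], hence is orthogonal to [b a]: the stiffness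
    matrix is strictly lower triangular. *)
Lemma stiff_eq0 k a : (a < 4)%N -> (k <= a)%N -> stiff R k a = 0.
Proof.
move=> ha ka; apply: dg_basis_orthogonal => //.
by apply: (leq_trans _ ka); apply: size_deriv_dg_basis; apply: (leq_ltn_trans _ ha).
Qed.

(** If this coefficient vanished, the derivative of [b k.+1] would have degree below [k], whereas in
    characteristic 0 differentiation lowers the degree by exactly one. *)
Lemma stiff_succ_neq0 k : (k.+1 < 4)%N -> stiff R k.+1 k != 0.
Proof.
move=> hk; apply/eqP => G0.
have := dg_basis_expansion k.+1 _ (ltnW hk) (size_deriv_dg_basis _ hk).
rewrite big_ord_recr/= -[polyip _ _]/(stiff R k.+1 k) G0 scale0r addr0 => dE.
have : (size ((b k.+1)^`())%R <= k)%N.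
  rewrite dE (leq_trans (size_sum _ _ _))//; apply/bigmax_leqP => i _.
  rewrite (leq_trans (size_scale_leq _ _))// size_dg_basis ?ltn_ord//.
  by apply: (ltn_trans (ltn_ord i)); lia.
rewrite leqNgt => /negP; apply.
by rewrite polyorder.size_deriv size_dg_basis.
Qed.

Lemma deriv_dg_basis n k : (k <= n)%N -> (n <= 4)%N -> (k < 4)%N ->
  (b k)^`()%R = \sum_(a < n) stiff R k a *: b a.
Proof.
move=> kn hn hk; apply: dg_basis_expansion => //.
by apply: leq_trans kn; exact: size_deriv_dg_basis.
Qed.

Lemma trace_l_neq0 k : (k < 4)%N -> trace_l R k != 0.
Proof.
move=> hk; rewrite /trace_l fmorph_eq0 dg_basisE// hornerZ mulf_neq0 ?dg_scale_neq0//.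
case: k hk => [|[|[|[|//]]]] _; rewrite horner_Poly/= ?mul0r ?add0r ?oner_neq0//;
  apply/eqP; lra.
Qed.

Lemma trace_r_neq0 k : (k < 4)%N -> trace_r R k != 0.
Proof.
move=> hk; rewrite /trace_r fmorph_eq0 dg_basisE// hornerZ mulf_neq0 ?dg_scale_neq0//.
case: k hk => [|[|[|[|//]]]] _; rewrite horner_Poly/= ?mul0r ?add0r ?oner_neq0//;
  apply/eqP; lra.
Qed.

Lemma trace_l0 : trace_l R 0 = 1.
Proof. by rewrite /trace_l hornerC. Qed.

Lemma trace_r0 : trace_r R 0 = 1.
Proof. by rewrite /trace_r hornerC. Qed.

End Basis.

(** * Moments of plane waves *)
Section Moments.
Context {R : realType}.
Implicit Types (p q : {poly R}).
Local Notation b := (dg_basis R).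
Local Notation normc := Normc.normc.

(** A crude bound for the supremum on the reference cell, where [|x| <= 1]. *)
Definition coef_norm p : R := \sum_(i < size p) `|p`_i|.

Lemma coef_norm_ge0 p : 0 <= coef_norm p.
Proof. exact: sumr_ge0. Qed.

Lemma horner_le_coef_norm p (x : R) : - 2^-1 <= x <= 2^-1 ->
  `|p.[x]| <= coef_norm p.
Proof.
move=> /andP[x1 x2]; rewrite horner_coef (le_trans (ler_norm_sum _ _ _))//.
apply: ler_sum => i _; rewrite normrM normrX ler_piMr// exprn_ile1//.
by rewrite ler_norml; apply/andP; split; lra.
Qed.

Definition polyipf p (f : R -> R) : R :=
  \int[@lebesgue_measure R]_(x in `[- 2^-1, 2^-1]) (p.[x] * f x).

Lemma polyipfB p f g : continuous f -> continuous g ->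
  polyipf p (fun x => f x - g x) = polyipf p f - polyipf p g.
Proof.
move=> cf cg; rewrite /polyipf -Rintegral_continuousB; try exact: continuousM_horner.
by apply: eq_Rintegral => x _; rewrite mulrBr.
Qed.

Lemma half_lt : - 2^-1 < 2^-1 :> R. Proof. lra. Qed.

Lemma polyipf_norm_le p (f : R -> R) e : continuous f ->
  (forall x : R, - 2^-1 <= x <= 2^-1 -> `|f x| <= e) ->
  `|polyipf p f| <= coef_norm p * e.
Proof.
move=> cf fe; have -> : coef_norm p * e = (coef_norm p * e) * (2^-1 - - 2^-1) by field.
apply: Rintegral_norm_le; first exact: ltW half_lt.
  exact: continuousM_horner.
by move=> x hx; rewrite normrM ler_pM ?fe ?horner_le_coef_norm.
Qed.

(* The left trace of the projection is exact on polynomials of degree below [n],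
   so only the remainder [f - p] contributes. *)
Lemma projection_trace_error n : (n <= 4)%N -> exists2 C, 0 <= C &
  forall (f : R -> R) p (e : R), continuous f -> (size p <= n)%N ->
  (forall x : R, - 2^-1 <= x <= 2^-1 -> `|f x - p.[x]| <= e) ->
  `|f (- 2^-1) - \sum_(k < n) polyipf (b k) f * (b k).[- 2^-1]| <= C * e.
Proof.
move=> hn.
exists (1 + \sum_(k < n) coef_norm (b k) * `|(b k).[- 2^-1]|).
  by apply: addr_ge0 => //; apply: sumr_ge0 => k _; rewrite mulr_ge0// coef_norm_ge0.
move=> f p e cf sp fpe.
have h0 : - 2^-1 <= (- 2^-1 : R) <= 2^-1 by rewrite lexx (ltW half_lt).
have cfp : continuous (fun x => f x - p.[x]).
  by move=> x; apply: cvgB; [exact: cf|exact: continuous_horner].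
have -> : f (- 2^-1) - \sum_(k < n) polyipf (b k) f * (b k).[- 2^-1] =
  (f (- 2^-1) - p.[- 2^-1]) -
  \sum_(k < n) polyipf (b k) (fun x => f x - p.[x]) * (b k).[- 2^-1].
  have -> : p.[- 2^-1] = \sum_(k < n) polyip p (b k) * (b k).[- 2^-1].
    rewrite [in LHS](dg_basis_expansion n p)// horner_sum.
    by apply: eq_bigr => k _; rewrite hornerZ.
  rewrite -addrA -opprD -big_split; congr (_ - _); apply: eq_bigr => k _ /=.
  rewrite polyipfB//; last exact: continuous_horner.
  by rewrite polyipC -mulrDl -[polyip _ _]/(polyipf (b k) (horner p)) addrC subrK.
rewrite (le_trans (ler_normB _ _))// mulrDl mul1r lerD ?fpe//.
rewrite (le_trans (ler_norm_sum _ _ _))// mulr_suml ler_sum// => k _.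
rewrite normrM mulrAC ler_wpM2r//.
exact: polyipf_norm_le.
Qed.

Lemma continuous_cosM (t : R) : continuous (fun x => cos (t * x)).
Proof.
move=> x; apply: (@continuous_comp R R R ( *%R t) cos).
  by apply: cvgMr; exact: cvg_id.
exact: continuous_cos.
Qed.

Lemma continuous_sinM (t : R) : continuous (fun x => sin (t * x)).
Proof.
move=> x; apply: (@continuous_comp R R R ( *%R t) sin).
  by apply: cvgMr; exact: cvg_id.
exact: continuous_sin.
Qed.

(** The integral of [p(x) e^(itx)] over the reference cell. For [p = b k] it is the [k]-th
    coefficient of the [L^2]-projection of the plane wave. *)
Definition moment p (t : R) : R[i] :=
  polyipf p (fun x => cos (t * x)) +i* polyipf p (fun x => sin (t * x)).

Lemma normc_le_Re_Im (z : R[i]) : normc z <= `|complex.Re z| + `|complex.Im z|.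
Proof.
case: z => x y /=; rewrite -[leRHS]ger0_norm ?addr_ge0// -sqrtr_sqr.
rewrite ler_wsqrtr// sqrrD !real_normK ?num_real// -addrA lerD2l.
by rewrite lerDr mulrn_wge0// mulr_ge0.
Qed.

Lemma moment_bounded p : exists C, forall t, normc (moment p t) <= C.
Proof.
exists (coef_norm p * 1 + coef_norm p * 1) => t.
apply: (le_trans (normc_le_Re_Im _)); rewrite /=.
apply: lerD; apply: polyipf_norm_le => //.
- exact: continuous_cosM.
- by move=> x _; rewrite ler_norml cos_geN1 cos_le1.
- exact: continuous_sinM.
- by move=> x _; rewrite ler_norml sin_geN1 sin_le1.
Qed.

(** The error at the left end of the cell made by the [L^2]-projection of [e^(itx)] onto degree
    below [n]. *)
Definition trace_defect n (t : R) : R[i] :=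
  cis (- (t / 2)) - \sum_(k < n) moment (b k) t * trace_l R k.

(** The projection estimate is applied to [cos (t x)] and [sin (t x)] separately, with their Taylor
    polynomials of degree below [n] in [t x]; the remainders are at most [|t|^n] on the cell. *)
Lemma trace_defect_bound n : (0 < n <= 4)%N ->
  exists C, forall t, normc (trace_defect n t) <= C * `|t| ^+ n.
Proof.
move=> /andP[n0 hn]; have [C C0 HC] := projection_trace_error n hn.
have [p [q [sp sq cp sqx]]] := @cos_sin_taylor R n.
exists (C + C) => t; apply: (le_trans (normc_le_Re_Im _)).
rewrite mulrDl.
have Re_sum (F : 'I_n -> R[i]) : complex.Re (\sum_i F i) = \sum_i complex.Re (F i).
  by apply: (big_morph (@complex.Re R)) => // -[x1 y1] [x2 y2].
have Im_sum (F : 'I_n -> R[i]) : complex.Im (\sum_i F i) = \sum_i complex.Im (F i).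
  by apply: (big_morph (@complex.Im R)) => // -[x1 y1] [x2 y2].
have ReB (x y : R[i]) : complex.Re (x - y) = complex.Re x - complex.Re y.
  by case: x y => [x1 y1] [x2 y2].
have ImB (x y : R[i]) : complex.Im (x - y) = complex.Im x - complex.Im y.
  by case: x y => [x1 y1] [x2 y2].
(* Substituting [t x] does not raise the degree. Since the size bound for a composite is at least 1,
   [0 < n] enters here. *)
have sc (r : {poly R}) : (size r <= n)%N -> (size (r \Po (t *: 'X)) <= n)%N.
  move=> sr; apply: (leq_trans (size_comp_poly_leq _ _)).
  have : (size (t *: 'X : {poly R}) <= 2)%N.
    by rewrite (leq_trans (size_scale_leq _ _))// size_polyX.
  by nia.
have tx (x : R) : - 2^-1 <= x <= 2^-1 -> `|t * x| ^+ n <= `|t| ^+ n.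
  move=> /andP[x1 x2]; rewrite normrM exprMn ler_piMr ?exprn_ge0//.
  by rewrite exprn_ile1// ler_norml; apply/andP; split; lra.
have -> : complex.Re (trace_defect n t) = (fun x => cos (t * x)) (- 2^-1) -
    \sum_(k < n) polyipf (b k) (fun x => cos (t * x)) * (b k).[- 2^-1].
  rewrite ReB/= mulrN; congr (_ - _).
  by rewrite Re_sum; apply: eq_bigr => k _ /=; rewrite mulr0 subr0.
have -> : complex.Im (trace_defect n t) = (fun x => sin (t * x)) (- 2^-1) -
    \sum_(k < n) polyipf (b k) (fun x => sin (t * x)) * (b k).[- 2^-1].
  rewrite ImB/= mulrN; congr (_ - _).
  by rewrite Im_sum; apply: eq_bigr => k _ /=; rewrite mulr0 add0r.
apply: lerD.
- apply: (HC _ (p \Po (t *: 'X))) => [||x hx]; [exact: continuous_cosM|exact: sc|].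
  rewrite horner_comp !hornerE; apply: (le_trans (cp _)); exact: tx.
- apply: (HC _ (q \Po (t *: 'X))) => [||x hx]; [exact: continuous_sinM|exact: sc|].
  rewrite horner_comp !hornerE; apply: (le_trans (sqx _)); exact: tx.
Qed.

(** Integration by parts against [e^(itx)], done on real and imaginary parts; [0 +i* t] is the
    number [i t]. *)
Lemma moment_by_parts p (t : R) :
  moment p^`() t = p.[2^-1]%:C * cis (t / 2) - p.[- 2^-1]%:C * cis (- (t / 2))
                 - (0 +i* t) * moment p t.
Proof.
have dp := is_derive_horner p.
have cp' := @continuous_horner R p^`().
have dL (x : R) : is_derive x 1 ( *%R t) t.
  have -> : *%R t = t \*: id :> (R -> R) by apply/funext.
  by apply: is_derive_eq; rewrite /GRing.scale/= mulr1.
have dcos (x : R) : is_derive x 1 (fun x => cos (t * x)) (- t * sin (t * x)).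
  have := dL x => ?; apply: is_derive_eq.
  by rewrite !mulNr mulrC.
have dsin (x : R) : is_derive x 1 (fun x => sin (t * x)) (t * cos (t * x)).
  have := dL x => ?; apply: is_derive_eq.
  by rewrite mulrC.
have cc : continuous (fun x => - t * sin (t * x)).
  by move=> x; apply: cvgMr; exact: continuous_sinM.
have cs : continuous (fun x => t * cos (t * x)).
  by move=> x; apply: cvgMr; exact: continuous_cosM.
have scal (c : R) (f : R -> R) : continuous f ->
  \int[@lebesgue_measure R]_(x in `[- 2^-1, 2^-1]) (p.[x] * (c * f x)) =
  c * polyipf p f.
  move=> cf; rewrite /polyipf -Rintegral_continuousZ; last exact: continuousM_horner.
  by apply: eq_Rintegral => x _; rewrite mulrCA.
have Ec : t * polyipf p (fun x => cos (t * x)) =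
    p.[2^-1] * sin (t * 2^-1) - p.[- 2^-1] * sin (t * - 2^-1)
    - polyipf p^`() (fun x => sin (t * x)).
  rewrite -scal; last exact: continuous_cosM.
  exact: (@Rintegral_by_parts R _ _ _ _ _ _ half_lt cp' dp cs dsin).
have Es : - t * polyipf p (fun x => sin (t * x)) =
    p.[2^-1] * cos (t * 2^-1) - p.[- 2^-1] * cos (t * - 2^-1)
    - polyipf p^`() (fun x => cos (t * x)).
  rewrite -scal; last exact: continuous_sinM.
  exact: (@Rintegral_by_parts R _ _ _ _ _ _ half_lt cp' dp cc dcos).
rewrite /moment /cis mulrN in Es Ec *.
apply/eqP; rewrite eq_complex /=; apply/andP; split; apply/eqP; lra.
Qed.

End Moments.

(** * Degrees of freedom of the Fourier mode and the Gauss-Radau projection *)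

Section DOF.
Context {R : realType}.
Implicit Types (p q : {poly R}).
Local Notation b := (dg_basis R).

Lemma CintegralZ (a c : R) (z : R[i]) (f : R -> R[i]) :
  continuous (fun x => complex.Re (f x)) ->
  continuous (fun x => complex.Im (f x)) ->
  Cintegral a c (fun x => z * f x) = z * Cintegral a c f.
Proof.
case: z => z1 z2 cr ci.
have cZ (g : R -> R) (w : R) : continuous g -> continuous (fun x => w * g x).
  by move=> cg x; apply: cvgMr; exact: cg.
rewrite /Cintegral; apply/eqP; rewrite eq_complex/=; apply/andP; split; apply/eqP.
- rewrite -!Rintegral_continuousZ// -Rintegral_continuousB; [|exact: cZ..].
  by apply: eq_Rintegral => x _; case: (f x).
- rewrite -!Rintegral_continuousZ// -Rintegral_continuousD; [|exact: cZ..].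
  by apply: eq_Rintegral => x _; case: (f x).
Qed.

Lemma Rintegral_centered (h : R) (f : R -> R) : 0 < h -> continuous f ->
  \int[@lebesgue_measure R]_(x in `[- (h / 2), h / 2]) f (x / h) =
  h * \int[@lebesgue_measure R]_(x in `[- 2^-1, 2^-1]) f x.
Proof.
move=> h0 cf; rewrite -(Rintegral_scale _ _ _ _ h0 half_lt cf).
by rewrite mulrN.
Qed.

Lemma continuous_scaled_horner p (h : R) : continuous (fun x : R => p.[x / h]).
Proof.
move=> x; apply: (@continuous_comp R R R (fun y => y / h) (horner p)).
  by apply: cvgMl; exact: cvg_id.
exact: continuous_horner.
Qed.

Lemma Cintegral_moment p (h k : R) : 0 < h ->
  Cintegral (- (h / 2)) (h / 2) (fun x => p.[x / h]%:C * cis (k * x)) =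
  h%:C * moment p (k * h).
Proof.
move=> h0; have hk (x : R) : k * x = k * h * (x / h) by field; rewrite gt_eqF.
have E (f : R -> R) : continuous f ->
    \int[@lebesgue_measure R]_(x in `[- (h / 2), h / 2]) (p.[x / h] * f (k * x)) =
    h * polyipf p (fun x => f (k * h * x)).
  move=> cf; rewrite -Rintegral_centered//.
    by apply: eq_Rintegral => x _; rewrite -hk.
  apply: continuousM_horner => x.
  apply: (@continuous_comp R R R ( *%R (k * h)) f); last exact: cf.
  by apply: cvgMr; exact: cvg_id.
rewrite /Cintegral /moment; apply/eqP; rewrite eq_complex/=.
rewrite !mul0r subr0 addr0 -!E; [|exact: continuous_sin|exact: continuous_cos].
apply/andP; split; apply/eqP; apply: eq_Rintegral => x _.
  by rewrite mul0r subr0.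
by rewrite mul0r addr0.
Qed.

(** The integrand separates in [x] and [y], so the inner integral contributes a constant factor to
    the outer one. Scaling to the reference cell gives one factor [h] per direction, cancelling the
    normalisation. *)
Lemma DOFhatE K (kx ky h : R) (i : 'I_(ndof K)) (k l : 'I_K.+1) (c : 'I_3) :
  0 < h -> enum_val i = (k, l, c) :> dof_index K ->
  DOFhat K kx ky h h i 0 =
  Qhat kx ky c 0 * (moment (b k) (kx * h) * moment (b l) (ky * h)).
Proof.
move=> h0 ei; rewrite mxE ei -mulrA; congr (_ * _).
have cc p (t : R) : continuous (fun x : R => complex.Re (p.[x / h]%:C * cis (t * x))).
  have -> : (fun x => complex.Re (p.[x / h]%:C * cis (t * x))) =
            (fun x => p.[x / h] * cos (t * x)).
    by apply/funext => x /=; rewrite mul0r subr0.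
  by move=> x; apply: cvgM; [exact: continuous_scaled_horner|exact: continuous_cosM].
have cs p (t : R) : continuous (fun x : R => complex.Im (p.[x / h]%:C * cis (t * x))).
  have -> : (fun x => complex.Im (p.[x / h]%:C * cis (t * x))) =
            (fun x => p.[x / h] * sin (t * x)).
    by apply/funext => x /=; rewrite mul0r addr0.
  by move=> x; apply: cvgM; [exact: continuous_scaled_horner|exact: continuous_sinM].
transitivity (((h * h)^-1)%:C * Cintegral (- (h / 2)) (h / 2) (fun x =>
    (h%:C * moment (b l) (ky * h)) * ((b k).[x / h]%:C * cis (kx * x)))).
  congr (_ * _); congr Cintegral; apply/funext => x.
  rewrite -Cintegral_moment// [RHS]mulrC -CintegralZ; [|exact: cc|exact: cs].
  by congr Cintegral; apply/funext => y; ring.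
rewrite CintegralZ; [|exact: cc|exact: cs].
rewrite Cintegral_moment// rmorphV/= ?unitfE ?mulf_neq0 ?gt_eqF// rmorphM/=.
field; rewrite fmorph_eq0 gt_eqF//.
Qed.

(* The Gauss-Radau projection: correcting the top moment makes the left trace
   exact. The downwind derivative sees only that trace and the moments below
   degree [K], so it maps [radau] exactly to [i t] times the moments. *)
Definition radau K (k : nat) (t : R) : R[i] :=
  moment (b k) t + (k == K)%:R * (trace_defect K.+1 t / trace_l R K).

(** Mesh width times the DG derivative whose interface value is taken from the right cell. It acts
    on the velocity in the [p] equation, where the entries 1 of [J] and -1 of [D] reduce the flux to
    its right state. *)
Definition adv_downwind (t : R) (k a : nat) : R[i] :=
  - (stiff R k a)%:C + (trace_r R k * cis t - trace_l R k) * trace_l R a.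

Lemma radau_trace K (t : R) : (K < 4)%N ->
  \sum_(a < K.+1) radau K a t * trace_l R a = cis (- (t / 2)).
Proof.
move=> hK; have tK := @trace_l_neq0 R _ hK.
rewrite (eq_bigr (fun a : 'I_K.+1 => moment (b a) t * trace_l R a +
  (a == ord_max)%:R * trace_defect K.+1 t)); last first.
  move=> a _; rewrite mulrDl; congr (_ + _).
  have -> : (a == ord_max) = (a == K :> nat) by [].
  by case: eqP => [->|_]; rewrite ?mul0r// !mul1r divfK.
have d1 : \sum_(a < K.+1) (a == ord_max)%:R = 1 :> R[i].
  by rewrite (bigD1 ord_max)//= eqxx big1 ?addr0// => i /negbTE ->.
by rewrite big_split/= -mulr_suml d1 mul1r /trace_defect addrC subrK.
Qed.

Lemma cisD (s t : R) : cis (s + t) = cis s * cis t.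
Proof.
rewrite /cis cosD sinD; apply/eqP.
by rewrite eq_complex/= addrC [_ * sin t + _]addrC !eqxx.
Qed.

Lemma moment_sum n (c : 'I_n -> R) (F : 'I_n -> {poly R}) t :
  moment (\sum_a c a *: F a) t = \sum_a (c a)%:C * moment (F a) t.
Proof.
have D p q : moment (p + q) t = moment p t + moment q t.
  have E (f : R -> R) : continuous f -> polyipf (p + q) f = polyipf p f + polyipf q f.
    move=> cf; rewrite /polyipf -Rintegral_continuousD; try exact: continuousM_horner.
    by apply: eq_Rintegral => x _; rewrite hornerD mulrDl.
  by rewrite /moment !E//; [exact: continuous_sinM|exact: continuous_cosM].
have Z w p : moment (w *: p) t = w%:C * moment p t.
  have E (f : R -> R) : continuous f -> polyipf (w *: p) f = w * polyipf p f.
    move=> cf; rewrite /polyipf -Rintegral_continuousZ; last exact: continuousM_horner.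
    by apply: eq_Rintegral => x _; rewrite hornerZ mulrA.
  rewrite /moment !E; [|exact: continuous_sinM|exact: continuous_cosM].
  by apply/eqP; rewrite eq_complex/= !mul0r subr0 addr0 !eqxx.
have M0 : moment 0 t = 0 by rewrite -(scale0r 0) Z mul0r.
by rewrite (big_morph _ D M0); apply: eq_bigr => a _; rewrite Z.
Qed.

(** The top column of the stiffness matrix is zero, so the Radau correction changes only the trace,
    making it exact. The flux terms then equal the boundary terms of [moment_by_parts], and only
    [i t] times the moment survives. *)
Lemma adv_downwind_radau K k (t : R) : (K < 4)%N -> (k <= K)%N ->
  \sum_(a < K.+1) adv_downwind t k a * radau K a t = (0 +i* t) * moment (b k) t.
Proof.
move=> hK kK.
rewrite (eq_bigr (fun a : 'I_K.+1 => - ((stiff R k a)%:C * moment (b a) t) +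
  (trace_r R k * cis t - trace_l R k) * (radau K a t * trace_l R a))); last first.
  move=> a _; rewrite /adv_downwind mulrDl; congr (_ + _); last by ring.
  rewrite mulNr /radau; case: (eqVneq (a : nat) K) => [aK|];
    last by rewrite mul0r addr0.
  by rewrite stiff_eq0 ?aK// !mul0r.
rewrite big_split/= sumrN -moment_sum -mulr_sumr radau_trace//.
rewrite -deriv_dg_basis ?(leq_ltn_trans kK)// ?(leq_trans kK)//.
rewrite moment_by_parts mulrBl -mulrA -cisD -/(trace_r R k) -/(trace_l R k).
rewrite [t + _](_ : _ = t / 2); last by field.
by ring.
Qed.

End DOF.

(** * The kernel of the evolution matrix *)
(** For [x] in the kernel put [S = \sum_a s a * x a]. Row 0 of [G] vanishes, so [g 0 * S = 0] and
    [S = 0]. The other rows then give [G x = 0], which kills all coordinates but the last, and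
    [S = 0] kills that one. *)
Lemma unitmx_rank1_sub_lower (F : fieldType) (K : nat) (G : 'M[F]_K.+1)
    (g s : 'I_K.+1 -> F) :
  (forall k a : 'I_K.+1, (k <= a)%N -> G k a = 0) ->
  (forall k a : 'I_K.+1, k = a.+1 :> nat -> G k a != 0) ->
  g ord0 != 0 -> s ord_max != 0 ->
  (\matrix_(k, a) (- G k a + g k * s a)) \in unitmx.
Proof.
move=> Gup Gsub g0 sK; rewrite -unitmx_tr -row_free_unit.
apply: inj_row_free => x Mx0.
have row k : - (\sum_a G k a * x 0 a) + g k * (\sum_a s a * x 0 a) = 0.
  move/matrixP : Mx0 => /(_ 0 k); rewrite !mxE => E; rewrite -[RHS]E.
  rewrite mulr_sumr -sumrN -big_split/=; apply: eq_bigr => a _.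
  by rewrite !mxE; ring.
have S0 : \sum_a s a * x 0 a = 0.
  have := row ord0; rewrite big1 ?oppr0 ?add0r; last first.
    by move=> a _; rewrite Gup// mul0r.
  by move/eqP; rewrite mulf_eq0 (negbTE g0) => /eqP.
(* Forward substitution in row [a + 1]: coordinates above [a] drop out by triangularity, those below
   by induction, and the subdiagonal entry is nonzero. *)
have low m : forall a : 'I_K.+1, (a < m)%N -> (a < K)%N -> x 0 a = 0.
  elim: m => // m IH a; rewrite ltnS leq_eqVlt => /predU1P[am aK|]; last exact: IH.
  have hk : (a.+1 < K.+1)%N by [].
  have := row (Ordinal hk); rewrite S0 mulr0 addr0 (bigD1 a)//= big1 ?addr0.
    by move=> /eqP; rewrite oppr_eq0 mulf_eq0 (negbTE (Gsub _ _ _))// => /eqP.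
  move=> c ca; have [ac|ac] := leqP a.+1 c; first by rewrite Gup ?mul0r.
  have cla : (c < a)%N by rewrite ltn_neqAle -(ltnS c a) ac andbT;
    apply: contra ca => /eqP/val_inj->.
  by rewrite IH ?mulr0// -?am//; exact: ltn_trans aK.
have x0 (a : 'I_K.+1) : (a < K)%N -> x 0 a = 0 by exact: low.
apply/rowP => a; rewrite mxE; have [aK|aK] := ltnP a K; first exact: x0.
have -> : a = ord_max by apply: val_inj => /=; have := ltn_ord a; lia.
move: S0; rewrite big_ord_recr/= big1 ?add0r.
  by move=> /eqP; rewrite mulf_eq0 (negbTE sK) => /eqP.
by move=> i _; rewrite x0 ?mulr0//= ltn_ord.
Qed.

(** The hypotheses say that reading off the coordinates in [I] is a bijection from the kernel of
    [E]. The matrix [T] reads them off, and the columns of [N] are kernel vectors lifting the unit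
    vectors. *)
Lemma rank_coker_coordinates (F : fieldType) n (E : 'M[F]_n) (I : {set 'I_n}) :
  (forall f : 'cV_n, exists2 q : 'cV_n,
    E *m q = 0 & forall i, i \in I -> q i 0 = f i 0) ->
  (forall q : 'cV_n, E *m q = 0 -> (forall i, i \in I -> q i 0 = 0) -> q = 0) ->
  \rank (cokermx E) = #|I|.
Proof.
move=> exq unq.
pose T : 'M[F]_(#|I|, n) := \matrix_(r, j) (enum_val r == j)%:R.
have TE m (A : 'M[F]_(n, m)) r j : (T *m A) r j = A (enum_val r) j.
  rewrite mxE (bigD1 (enum_val r))//= mxE eqxx mul1r big1 ?addr0// => i ir.
  by rewrite mxE eq_sym (negbTE ir) mul0r.
have exN (r : 'I_#|I|) : exists q : 'cV[F]_n, E *m q = 0 /\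
    forall s, q (enum_val s) 0 = (s == r)%:R.
  have [q Eq qI] := exq (\col_i (i == enum_val r)%:R).
  exists q; split => // s; rewrite qI ?enum_valP// mxE (inj_eq enum_val_inj)//.
have [N0 N0P] := choice exN.
pose N : 'M[F]_(n, #|I|) := \matrix_(i, r) N0 r i 0.
have EN : E *m N = 0.
  apply/matrixP => i r; have /colP/(_ i) := (N0P r).1; rewrite !mxE => EN0.
  rewrite -[RHS]EN0.
  by apply: eq_bigr => j _; rewrite mxE.
have TN : T *m N = 1%:M.
  by apply/matrixP => s r; rewrite TE !mxE (N0P r).2.
have rN : (#|I| <= \rank N)%N.
  by rewrite -{1}(mxrank1 F #|I|) -TN; exact: mxrankM_maxr.
(* Columns of both sides lie in the kernel and agree on [I], so uniqueness identifies them. *)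
have CE : cokermx E = N *m (T *m cokermx E).
  apply/eqP; rewrite -subr_eq0; apply/eqP/matrixP => i j.
  set Z := _ - _; suff /colP/(_ i) : col j Z = 0 by rewrite mxE => ->; rewrite !mxE.
  apply: unq.
    by rewrite colE mulmxA mulmxBr mulmx_coker (mulmxA E N) EN mul0mx subrr mul0mx.
  move=> u uI; rewrite mxE -(enum_rankK_in uI uI) -TE mulmxBr.
  by rewrite [T *m (N *m _)]mulmxA TN mul1mx subrr mxE.
apply/eqP; rewrite eqn_leq; apply/andP; split.
  by rewrite CE (leq_trans (mxrankM_maxl _ _))// rank_leq_col.
rewrite mxrank_coker (leq_trans rN)//.
by have := mulmx0_rank_max EN; lia.
Qed.

(** * Component form of the evolution matrix for the Low Mach flux *)

Section Evolution.
Context {R : realType}.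
Variable K : nat.
Hypothesis hK : (K < 4)%N.
Local Notation b := (dg_basis R).
Local Notation C := R[i].

Lemma cis_neq0 (t : R) : cis t != 0.
Proof.
apply/eqP => -[c0 s0]; have := cos2Dsin2 t.
by rewrite c0 s0 !expr0n addr0 => /eqP; rewrite eq_sym oner_eq0.
Qed.

(** Counterpart of [adv_downwind] with the interface value from the left cell: in the velocity
    equations the entries of [J] and [D] acting on [p] are both 1. *)
Definition adv_upwind (t : R) (k a : nat) : C :=
  - (stiff R k a)%:C + (trace_r R k - trace_l R k / cis t) * trace_r R a.

(** The contribution of the entry 2 of [D]: a penalty on interface jumps of [p], felt only by the
    [p] equation. *)
Definition jump_diffusion (t : R) (k a : nat) : C :=
  (trace_r R k - trace_l R k / cis t) * (trace_r R a - cis t * trace_l R a).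

Definition dgmx (f : nat -> nat -> C) : 'M[C]_K.+1 := \matrix_(k, a) f k a.

(** Arranging one component as a matrix turns the tensor structure into multiplication: operators in
    [x] act on the left, those in [y] act transposed on the right. *)
Definition component (c : 'I_3) (q : 'cV[C]_(ndof K)) : 'M[C]_K.+1 :=
  \matrix_(k, l) q (enum_rank ((k, l, c) : dof_index K)) 0.

Definition c_u : 'I_3 := ord0.
Definition c_v : 'I_3 := lift ord0 ord0.
Definition c_p : 'I_3 := ord_max.

Definition dof_state (U V P : 'M[C]_K.+1) : 'cV[C]_(ndof K) :=
  \col_i let: (k, l, c) := enum_val i : dof_index K in
    nth 0 [:: U k l; V k l; P k l] c.

Lemma component_dof_state U V P :
  [/\ component c_u (dof_state U V P) = U, component c_v (dof_state U V P) = V &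
      component c_p (dof_state U V P) = P].
Proof. by split; apply/matrixP => k l; rewrite !mxE enum_rankK. Qed.

Lemma ord3P (c : 'I_3) : [\/ c = c_u, c = c_v | c = c_p].
Proof.
by case: c => [[|[|[|//]]] hc]; [constructor 1|constructor 2|constructor 3];
  apply: val_inj.
Qed.

Lemma dof_state_eq (q q' : 'cV[C]_(ndof K)) :
  (forall c, component c q = component c q') -> q = q'.
Proof.
move=> qq'; apply/colP => i; rewrite -(enum_valK i).
case: (enum_val i) => [[k l] c].
by have /matrixP/(_ k l) := qq' c; rewrite !mxE.
Qed.

Lemma evolution_block_low_mach kx ky h k l a m c c' :
  0 < h -> (k < 4)%N -> (l < 4)%N -> (a < 4)%N -> (m < 4)%N ->
  evolution_block (low_mach_D_x R) (low_mach_D_y R) kx ky h h k l a m c c' =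
  (h^-1)%:C * ((l == m)%:R * mx3 [:: [:: 0; 0; adv_upwind (kx * h) k a];
      [:: 0; 0; 0]; [:: adv_downwind (kx * h) k a; 0; jump_diffusion (kx * h) k a]] c c'
   + (k == a)%:R * mx3 [:: [:: 0; 0; 0]; [:: 0; 0; adv_upwind (ky * h) l m];
      [:: 0; adv_downwind (ky * h) l m; jump_diffusion (ky * h) l m]] c c').
Proof.
move=> h0 k4 l4 a4 m4; rewrite /evolution_block !mass_delta//.
rewrite /num_flux /adv_upwind /adv_downwind /jump_diffusion.
have tx := cis_neq0 (kx * h); have ty := cis_neq0 (ky * h).
have hC : h%:C != 0 by rewrite fmorph_eq0 gt_eqF.
rewrite !rmorphM/= !rmorph_nat !fmorphV/=.
set Gx := (stiff R k a)%:C; set Gy := (stiff R l m)%:C.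
move: (cis _) (cis _) tx ty => X Y X0 Y0.
by case: (ord3P c) => ->; case: (ord3P c') => ->; rewrite !mxE/=;
  field; rewrite ?X0 ?Y0 ?hC.
Qed.

Lemma component_evolution kx ky h (q : 'cV[C]_(ndof K)) : 0 < h ->
  let Eq := evolution K (low_mach_D_x R) (low_mach_D_y R) kx ky h h *m q in
  [/\ component c_u Eq = (h^-1)%:C *: (dgmx (adv_upwind (kx * h)) *m component c_p q),
      component c_v Eq = (h^-1)%:C *: (component c_p q *m (dgmx (adv_upwind (ky * h)))^T) &
      component c_p Eq = (h^-1)%:C *:
        (dgmx (adv_downwind (kx * h)) *m component c_u q
         + component c_v q *m (dgmx (adv_downwind (ky * h)))^T
         + (dgmx (jump_diffusion (kx * h)) *m component c_p q
         + component c_p q *m (dgmx (jump_diffusion (ky * h)))^T))].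
Proof.
move=> h0 Eq.
have lt4 (k : 'I_K.+1) : (k < 4)%N by apply: leq_trans (ltn_ord k) _.
(* Here [mx3] is taken over the ring of square matrices: a 3 by 3 matrix of DG operators, one for
   each pair of components. *)
pose BX t := mx3 [:: [:: 0; 0; dgmx (adv_upwind t)]; [:: 0; 0; 0];
   [:: dgmx (adv_downwind t); 0; dgmx (jump_diffusion t)]].
pose BY t := mx3 [:: [:: 0; 0; 0]; [:: 0; 0; dgmx (adv_upwind t)];
   [:: 0; dgmx (adv_downwind t); dgmx (jump_diffusion t)]].
have main c : component c Eq = (h^-1)%:C *: \sum_c'
   (BX (kx * h) c c' *m component c' q +
    component c' q *m (BY (ky * h) c c')^T).
  apply/matrixP => k l; rewrite !mxE summxE mulr_sumr.
  rewrite (reindex (@enum_rank (dof_index K))) /=; last first.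
    by exists enum_val => x _; rewrite ?enum_rankK ?enum_valK.
  rewrite (eq_bigr (fun x : dof_index K => (h^-1)%:C *
     (((l == x.1.2)%:R * BX (kx * h) c x.2 k x.1.1 +
       (k == x.1.1)%:R * BY (ky * h) c x.2 l x.1.2) *
        component x.2 q x.1.1 x.1.2))); last first.
    case=> [[a m] c'] _ /=; rewrite !mxE !enum_rankK evolution_block_low_mach//.
    rewrite -mulrA; congr (_ * (_ * _)).
    by congr (_ * _ + _ * _); case: (ord3P c) => ->; case: (ord3P c') => ->;
      rewrite !mxE.
  rewrite -(pair_bigA _ (fun km c' => (h^-1)%:C *
     (((l == km.2)%:R * BX (kx * h) c c' k km.1 +
       (k == km.1)%:R * BY (ky * h) c c' l km.2) * component c' q km.1 km.2)))/=.
  rewrite exchange_big/=; apply: eq_bigr => c' _.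
  rewrite -(pair_bigA _ (fun a m => (h^-1)%:C *
     (((l == m)%:R * BX (kx * h) c c' k a +
       (k == a)%:R * BY (ky * h) c c' l m) * component c' q a m)))/=.
  under eq_bigr do rewrite -mulr_sumr.
  rewrite -mulr_sumr; congr (_ * _); rewrite [RHS]mxE.
  under eq_bigr do (under eq_bigr do rewrite mulrDl; rewrite big_split/=).
  rewrite big_split/=; congr (_ + _); rewrite [RHS]mxE.
    apply: eq_bigr => a _; rewrite (bigD1 l)//= eqxx mul1r big1 ?addr0//.
    by move=> m /negbTE; rewrite eq_sym => ->; rewrite !mul0r.
  rewrite (bigD1 k)//= [X in _ + X]big1 ?addr0.
    by apply: eq_bigr => m _; rewrite eqxx mul1r [RHS]mulrC [in RHS]mxE.
  by move=> a /negbTE; rewrite eq_sym => ak; rewrite big1// => m _; rewrite ak !mul0r.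
split; rewrite main !big_ord_recl big_ord0 /BX /BY !mxE/=.
all: rewrite (_ : lift ord0 (lift ord0 ord0) = c_p); last exact: val_inj.
all: by rewrite ?trmx0 ?mul0mx ?mulmx0 ?addr0 ?add0r ?addrA.
Qed.

Lemma stiff_rank1_unit (g s : nat -> C) : g 0 != 0 -> s K != 0 ->
  dgmx (fun k a => - (stiff R k a)%:C + g k * s a) \in unitmx.
Proof.
move=> g0 sK; pose G : 'M[C]_K.+1 := \matrix_(k, a) (stiff R k a)%:C.
have -> : dgmx (fun k a => - (stiff R k a)%:C + g k * s a) =
    \matrix_(k, a) (- G k a + g k * s a).
  by apply/matrixP => k a; rewrite !mxE.
apply: (@unitmx_rank1_sub_lower _ _ G (fun k => g k) (fun a => s a)) => //.
- by move=> k a ka; rewrite mxE stiff_eq0// (leq_trans (ltn_ord a)).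
- move=> k a ka; rewrite mxE fmorph_eq0 ka stiff_succ_neq0// -ka.
  by rewrite (leq_trans (ltn_ord k)).
Qed.

(** Both traces of [b 0] are 1, so [cis t != 1] is precisely the condition [g 0 != 0] of the
    rank-one criterion. *)
Lemma adv_downwind_unit (t : R) : cis t != 1 -> dgmx (adv_downwind t) \in unitmx.
Proof.
move=> t1; apply: (@stiff_rank1_unit (fun k => trace_r R k * cis t - trace_l R k)).
  by rewrite trace_r0 trace_l0 mul1r subr_eq0.
exact: trace_l_neq0.
Qed.

Lemma adv_upwind_unit (t : R) : cis t != 1 -> dgmx (adv_upwind t) \in unitmx.
Proof.
move=> t1; apply: (@stiff_rank1_unit (fun k => trace_r R k - trace_l R k / cis t)).
  by rewrite trace_r0 trace_l0 mul1r subr_eq0 eq_sym -[1]invr1 (inj_eq invr_inj).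
exact: trace_r_neq0.
Qed.

(** * The kernel at a fixed mesh width *)

Section FixedMesh.
Variables (kx ky h : R).
Hypothesis h_gt0 : 0 < h.
Local Notation E := (evolution K (low_mach_D_x R) (low_mach_D_y R) kx ky h h).

Lemma evolution_dof_state U V :
  dgmx (adv_downwind (kx * h)) *m U + V *m (dgmx (adv_downwind (ky * h)))^T = 0 ->
  E *m dof_state U V 0 = 0.
Proof.
move=> UV; have [eu ev ep] := component_evolution kx ky h (dof_state U V 0) h_gt0.
have [cu cv cp] := component_dof_state U V 0.
have c0 c : component c 0 = 0 by apply/matrixP => k l; rewrite !mxE.
apply: dof_state_eq => c; rewrite c0; case: (ord3P c) => ->.
- by rewrite eu cp mulmx0 scaler0.
- by rewrite ev cp mul0mx scaler0.
- by rewrite ep cp cu cv UV mulmx0 mul0mx !addr0 scaler0.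
Qed.

(** The [u] equation forces [p = 0] by invertibility of the upwind derivative in [x]; with [u = 0]
    the [p] equation then forces [v = 0] by that of the downwind derivative in [y]. *)
Lemma evolution_ker_inj q : cis (kx * h) != 1 -> cis (ky * h) != 1 ->
  E *m q = 0 -> component c_u q = 0 -> q = 0.
Proof.
move=> tx ty Eq0 qu.
have hC : (h^-1)%:C != 0 by rewrite fmorph_eq0 invr_eq0 gt_eqF.
have c0 c : component c 0 = 0 by apply/matrixP => k l; rewrite !mxE.
have [] := component_evolution kx ky h q h_gt0; rewrite Eq0 !c0 => eu _ ep.
have qp : component c_p q = 0.
  move/esym/eqP : eu; rewrite scaler_eq0 (negbTE hC) => /eqP Ap.
  by rewrite -[LHS](mulKmx (adv_upwind_unit _ tx)) Ap mulmx0.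
have qv : component c_v q = 0.
  move/esym/eqP : ep; rewrite scaler_eq0 (negbTE hC) qp qu !mulmx0 mul0mx add0r !addr0.
  move=> /eqP Av; have ut : (dgmx (adv_downwind (ky * h)))^T \in unitmx.
    by rewrite unitmx_tr adv_downwind_unit.
  by rewrite -[LHS](mulmxK ut) Av mul0mx.
by apply: dof_state_eq => c; rewrite c0; case: (ord3P c) => ->.
Qed.

Lemma evolution_ker_extend U : cis (ky * h) != 1 ->
  exists2 q, E *m q = 0 & component c_u q = U.
Proof.
move=> ty; have ut : (dgmx (adv_downwind (ky * h)))^T \in unitmx.
  by rewrite unitmx_tr adv_downwind_unit.
(* The velocity [v] solving the divergence equation for the given [u], with zero pressure. *)
exists (dof_state U (- (dgmx (adv_downwind (kx * h)) *m U *m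
  invmx (dgmx (adv_downwind (ky * h)))^T)) 0).
  by apply: evolution_dof_state; rewrite mulNmx mulmxKV// subrr.
by have [] := component_dof_state U (- (dgmx (adv_downwind (kx * h)) *m U *m
  invmx (dgmx (adv_downwind (ky * h)))^T)) 0.
Qed.

(** Each component uses the Radau projection in the direction in which the divergence differentiates
    it, and the [L^2]-projection in the other. *)
Definition steady_mode : 'cV[C]_(ndof K) :=
  dof_state (\matrix_(k, l) ((- ky)%:C * (radau K k (kx * h) * moment (b l) (ky * h))))
    (\matrix_(k, l) (kx%:C * (moment (b k) (kx * h) * radau K l (ky * h)))) 0.

(** Both derivatives are exact multiples of the same product of moments, with factors
    [- k_y * i k_x h] and [k_x * i k_y h], which cancel. *)
Lemma steady_mode_ker : E *m steady_mode = 0.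
Proof.
apply: evolution_dof_state; apply/matrixP => k l; rewrite !mxE.
have hk := ltn_ord k; have hl := ltn_ord l.
have kr := @adv_downwind_radau R K k (kx * h) hK hk.
have lr := @adv_downwind_radau R K l (ky * h) hK hl.
transitivity ((- ky)%:C * moment (b l) (ky * h) *
    (\sum_(a < K.+1) adv_downwind (kx * h) k a * radau K a (kx * h)) +
  kx%:C * moment (b k) (kx * h) *
    (\sum_(a < K.+1) adv_downwind (ky * h) l a * radau K a (ky * h))).
  rewrite !mulr_sumr; congr (_ + _); apply: eq_bigr => a _; rewrite !mxE; ring.
have ih (t : R) : (0 +i* (t * h)) = 'i * h%:C * t%:C.
  by apply/eqP; rewrite eq_complex/=; apply/andP; split; apply/eqP; ring.
by rewrite kr lr !ih rmorphN; ring.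
Qed.

End FixedMesh.
End Evolution.

(** * Error estimates *)
Section Estimates.
Context {R : realType}.
Local Notation normc := Normc.normc.

Lemma normc_ge0 (z : R[i]) : 0 <= normc z.
Proof. by case: z => x y; exact: sqrtr_ge0. Qed.

Lemma bigO_powP (m : nat) (f : R -> R[i]) :
  (exists c, (\forall h \near 0^'+, normc (f h) <= c * h ^+ m)%classic) -> bigO_pow m f.
Proof.
move=> [c fc]; rewrite /bigO_pow; apply/eqO_exP.
(* The characterisation of big-O asks for a positive constant, while [c] may be 0 or negative. *)
exists (`|c| + 1); first by rewrite ltr_wpDl.
near=> h.
have h0 : 0 < h by near: h; exact: nbhs_right_gt.
have hm : 0 <= h ^+ m by rewrite exprn_ge0 ?ltW.
rewrite /= (ger0_norm hm) (ger0_norm (normc_ge0 _)).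
apply: (@le_trans _ _ (c * h ^+ m)); first by near: h.
apply: ler_wpM2r => //.
by have := ler_norm c; lra.
Unshelve. all: by end_near. Qed.

(** For [0 < h < pi / |k|] the sine of [|k| h] is positive, so [cis (k * h)] is not real. *)
Lemma cis_near_neq1 (k : R) : k != 0 ->
  (\forall h \near 0^'+, cis (k * h) != 1)%classic.
Proof.
move=> k0; near=> h; apply/eqP => -[_ s0].
have h0 : 0 < h by near: h; exact: nbhs_right_gt.
have hpi : h < pi / `|k|.
  by near: h; apply: nbhs_right_lt; rewrite divr_gt0 ?pi_gt0 ?normr_gt0.
have : 0 < sin (`|k| * h).
  apply: sin_gt0_pi; rewrite mulr_gt0 ?normr_gt0//= mulrC.
  by rewrite -ltr_pdivlMr ?normr_gt0.
have [k1|k1] := ger0P k; first by rewrite s0 ltxx.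
by rewrite mulNr sinN s0 oppr0 ltxx.
Unshelve. all: by end_near. Qed.

(** The two projections differ only at [k = K], by a multiple of the trace defect, which is of order
    [K + 1]; the other factor is a bounded moment. *)
Lemma radau_error (K k : nat) (p : {poly R}) (m : R[i]) (s s' : R) :
  (K < 4)%N -> exists d, forall h : R, 0 < h ->
    normc (m * ((radau K k (s * h) - moment (dg_basis R k) (s * h)) *
      moment p (s' * h))) <= d * h ^+ K.+1.
Proof.
move=> hK; have [B HB] := @trace_defect_bound R K.+1 hK.
have [C HC] := moment_bounded p.
have C0 : 0 <= C by apply: le_trans (HC 0); exact: normc_ge0.
pose tK := normc (trace_l R K)^-1.
exists (normc m * (`|B| * `|s| ^+ K.+1 * tK * C)) => h h0.
have -> : normc m * (`|B| * `|s| ^+ K.+1 * tK * C) * h ^+ K.+1 =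
    normc m * (`|B| * `|s * h| ^+ K.+1 * tK * C).
  by rewrite normrM exprMn (gtr0_norm h0); ring.
rewrite !Normc.normcM ler_wpM2l ?normc_ge0// ler_pM ?normc_ge0//.
rewrite /radau addrAC subrr add0r; case: eqP => _; last first.
  by rewrite mul0r Normc.normc0 !mulr_ge0 ?normc_ge0.
rewrite mul1r Normc.normcM ler_wpM2r ?normc_ge0// (le_trans (HB _))//.
by rewrite ler_wpM2r ?exprn_ge0// ler_norm.
Qed.

Lemma DOFhat_steady_mode_error (K : nat) (kx ky : R) (i : 'I_(ndof K)) :
  (K < 4)%N -> exists c, forall h : R, 0 < h ->
  normc ((DOFhat K kx ky h h - steady_mode K kx ky h) i 0) <= c * h ^+ K.+1.
Proof.
move=> hK; case ei : (enum_val i : dof_index K) => [[k l] c].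
(* The factors [k_y] and [- k_x] are those of [Qhat] with the sign reversed, because the difference
   [DOF - w] contains [c - r] rather than [r - c]. *)
have [d1 H1] := radau_error K k (dg_basis R l) ky%:C kx ky hK.
have [d2 H2] := radau_error K l (dg_basis R k) (- kx%:C) ky kx hK.
have DE h : 0 < h -> (DOFhat K kx ky h h - steady_mode K kx ky h) i 0 =
    Qhat kx ky c 0 * (moment (dg_basis R k) (kx * h) * moment (dg_basis R l) (ky * h))
    - nth 0 [:: (- ky)%:C * (radau K k (kx * h) * moment (dg_basis R l) (ky * h));
       kx%:C * (moment (dg_basis R k) (kx * h) * radau K l (ky * h)); 0] c.
  by move=> h0; rewrite mxE (DOFhatE _ _ _ _ _ _ _ _ h0 ei) !mxE ei !mxE.
case: (ord3P c) => cE; rewrite cE in DE.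
- exists d1 => h h0; rewrite DE// mxE/= (le_trans _ (H1 h h0))// rmorphN.
  by rewrite le_eqVlt; apply/orP; left; apply/eqP; congr normc; ring.
- exists d2 => h h0; rewrite DE// mxE/= (le_trans _ (H2 h h0))//.
  by rewrite le_eqVlt; apply/orP; left; apply/eqP; congr normc; ring.
- by exists 0 => h h0; rewrite DE// mxE/= !mul0r !subr0 addr0 expr0n addr0 sqrtr0.
Qed.

End Estimates.

(** * The affine projector and its properties *)

Theorem mainTheorem8 (R : realType) (K : nat) (hK : (1 <= K <= 3)%N)
    (kx ky : R) (hk : kx * ky != 0) :
  exists proj : R -> 'cV[R[i]]_(ndof K) -> 'cV[R[i]]_(ndof K),
    selectively_optimal_projector
      (fun dx => evolution K (low_mach_D_x R) (low_mach_D_y R) kx ky dx dx) proj /\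
    (forall i : 'I_(ndof K),
      bigO_pow K.+1 (fun dx =>
        (DOFhat K kx ky dx dx - proj dx (DOFhat K kx ky dx dx)) i 0)).
Proof.
have K4 : (K < 4)%N by lia.
move: hk; rewrite mulf_eq0 negb_or => /andP[kx0 ky0].
pose E dx := evolution K (low_mach_D_x R) (low_mach_D_y R) kx ky dx dx.
pose D dx := DOFhat K kx ky dx dx; pose w dx := steady_mode K kx ky dx.
have [S [ES SE]] : exists S : R -> 'cV[R[i]]_(ndof K) -> 'cV[R[i]]_(ndof K),
    (forall dx f, E dx *m S dx f = 0) /\ (forall dx f, 0 < dx ->
      cis (ky * dx) != 1 -> component K c_u (S dx f) = component K c_u f).
  (* The default 0 keeps the value in the kernel even at mesh widths where no extension exists, as
     membership is required for every [dx > 0]. *)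
  exists (fun dx f => xget 0 [set q : 'cV[R[i]]_(ndof K) |
    E dx *m q = 0 /\ component K c_u q = component K c_u f]%classic).
  split=> [dx f|dx f dx0 ty]; case: xgetP => [q _ []//|noq].
    by rewrite mulmx0.
  have [q Eq qf] := evolution_ker_extend K K4 kx ky dx dx0 (component K c_u f) ty.
  by have := noq q; case.
(* [S] is a choice, not known to be linear, so its value at 0 comes from uniqueness. *)
have S0 dx : 0 < dx -> cis (kx * dx) != 1 -> cis (ky * dx) != 1 -> S dx 0 = 0.
  move=> dx0 tx ty; apply: (evolution_ker_inj K K4 kx ky dx dx0 _ tx ty (ES dx 0)).
  by rewrite SE//; apply/matrixP => k l; rewrite !mxE.
have err i := DOFhat_steady_mode_error K kx ky i K4.
pose I := [set i : 'I_(ndof K) | (enum_val i : dof_index K).2 == c_u].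
have compI (q f : 'cV[R[i]]_(ndof K)) i :
    component K c_u q = component K c_u f -> i \in I ->
    q i 0 = f i 0.
  rewrite inE -{2 3}(enum_valK i); case: (enum_val i) => [[k l] c] /=.
  by move=> /matrixP/(_ k l); rewrite !mxE => qf /eqP ->.
have Icomp (q : 'cV[R[i]]_(ndof K)) : (forall i, i \in I -> q i 0 = 0) ->
    component K c_u q = 0.
  by move=> qI; apply/matrixP => k l; rewrite !mxE qI// inE enum_rankK.
(* At [q = D dx] the argument of [S] is 0, so the projector returns [w dx] and its error is that of
   the steady mode. *)
exists (fun dx q => w dx + S dx (q - D dx)); split; last first.
  move=> i; apply: bigO_powP; have [c cP] := err i; exists c.
  near=> dx.
  have dx0 : 0 < dx by near: dx; exact: nbhs_right_gt.
  have tx : cis (kx * dx) != 1 by near: dx; exact: cis_near_neq1.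
  have ty : cis (ky * dx) != 1 by near: dx; exact: cis_near_neq1.
  by rewrite subrr S0// addr0; exact: cP.
split.
  by move=> dx dx0 q; rewrite mulmxDr ES steady_mode_ker// addr0.
exists I; split.
  near=> dx.
  have dx0 : 0 < dx by near: dx; exact: nbhs_right_gt.
  have tx : cis (kx * dx) != 1 by near: dx; exact: cis_near_neq1.
  have ty : cis (ky * dx) != 1 by near: dx; exact: cis_near_neq1.
  apply/esym/rank_coker_coordinates => [f|q Eq qI].
    exists (S dx f); first exact: ES.
    by move=> i iI; apply: compI iI; exact: SE.
  exact: (evolution_ker_inj K K4 kx ky dx dx0 q tx ty Eq (Icomp q qI)).
move=> i iI q; apply: bigO_powP; have [c cP] := err i; exists c.
near=> dx.
have dx0 : 0 < dx by near: dx; exact: nbhs_right_gt.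
have ty : cis (ky * dx) != 1 by near: dx; exact: cis_near_neq1.
(* On [I] the section reproduces [q - D dx], so [q] cancels and the error is [w - D], with a
   constant independent of [q]. *)
have -> : (w dx + S dx (q - D dx)) i 0 - q i 0 = - (D dx - w dx) i 0.
  have := compI _ _ i (SE dx (q - D dx) dx0 ty) iI.
  by rewrite !mxE => ->; ring.
by rewrite normcN; exact: cP.
Unshelve. all: by end_near. Qed.
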